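(* Let $\varepsilon>0$. Consider the resource allocation problem $$\min\Big\{ f(\mathtt x)=\sum_{k=1}^n f_k(x_k)\ :\ \sum_{k=1}^n y_k\ge C,\ x_k\ge y_k,\ y_k\ge0,\ x_k\ge0,\ k=1,\dots,n\Big\}$$ and let $\mathtt x^*$ be (the $\mathtt x$-part of) its solution. Suppose it is to be solved in the sense $$f(\mathtt x^N)-f(\mathtt x^* )\le\varepsilon,\qquad C-\sum_{k=1}^n x_k^N\le\frac{\varepsilon}{p_{\max}}.\tag{$*$}$$ Apply to the dual problem $\min_{\mathtt p\ge0}\varphi(\mathtt p)$ the projected subgradient method $$\mathtt p^{t+1}=\big[\mathtt p^t-h\nabla\varphi(\mathtt p^t)\big]_+,\qquad \mathtt p^0=\mathtt 0,$$ with the stopping criterion on the duality gap and on the constraint violation $$f(\mathtt x^N)+\varphi(\bar{\mathtt p}^N)\le\varepsilon,\qquad C-\sum_{k=1}^n x_k^N\le\frac{\varepsilon}{p_{\max}},\tag{$**$}$$ where $\mathtt x^N=\frac1N\sum_{t=0}^{N-1}\mathtt x(\mathtt p^t)$ and $\bar{\mathtt p}^N=\frac1N\sum_{t=0}^{N-1}\mathtt p^t$. Then $( ** )$ implies $( * )$, and with the step size $$h=\frac{3p_{\max}\sqrt n}{M\sqrt N}=\frac{\varepsilon}{M^2},\qquad\text{where } N=\frac{9n(Mp_{\max})^2}{\varepsilon^2},$$ the method is guaranteed to stop (i.e. the criterion $( ** )$ is satisfied) after no more than $$N=\frac{9n(Mp_{\max})^2}{\varepsilon^2}$$ iterations (rounded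 up to an integer).
   Context: Setting. $n\ge1$ is an integer, $C>0$, $\mu>0$, and $f_k:[0,\infty)\to\mathbb R$, $k=1,\dots,n$, are increasing, $\mu$-strongly convex functions (cost functions of $n$ enterprises). For $p_k\ge0$ let $x_k(p_k)=\operatorname{arg\,max}_{x\ge0}\{p_kx-f_k(x)\}$ (unique by strong convexity), and for $\mathtt p=(p_1,\dots,p_n)^\top\ge0$ let $\mathtt x(\mathtt p)=(x_1(p_1),\dots,x_n(p_n))^\top$. The dual function (dual problem up to sign) is $$\varphi(\mathtt p)=\sum_{k=1}^n\{p_kx_k(p_k)-f_k(x_k(p_k))\}-C\min_{k=1,\dots,n}p_k ,\qquad \mathtt p\ge0.$$ $\nabla\varphi(\mathtt p)$ denotes a subgradient of $\varphi$ of the form $$\nabla\varphi(\mathtt p)=\mathtt x(\mathtt p)-C\lambda(\mathtt p),$$ where $\lambda(\mathtt p)=(\lambda_1,\dots,\lambda_n)^\top$ satisfies $\lambda_k\ge0$, $\sum_k\lambda_k=1$, and $\lambda_k>0$ only if $p_k=\min_{j}p_j$; the choice of $\lambda(\mathtt p)$ among such vectors is arbitrary. $[\cdot]_+$ is the componentwise positive part, i.e. the projection onto $\{\mathtt p\ge0\}$. Put $$p_{\max}=\frac1C\sum_{k=1}^n\Big\{f_k\Big(\frac{2C}{n}\Big)-f_k(0)\Big\},\qquad R=p_{\max}\sqrt n,$$ and $B^+_{3R}(0)=\{\mathtt p\in\mathbb R^n:\mathtt p\ge0,\ \|\mathtt p\|_2\le3R\}$. $M>0$ is a constant such that $\|\nabla\varphi(\mathtt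 p)\|_2=\|\mathtt x(\mathtt p)-C\lambda(\mathtt p)\|_2\le M$ for all $\mathtt p\in B^+_{3R}(0)$. *)

(* Defs.v *)
From HB Require Import structures.
From mathcomp Require Import all_boot all_order all_algebra.
From mathcomp Require Import boolp classical_sets reals.

Set Implicit Arguments.
Unset Strict Implicit.
Unset Printing Implicit Defensive.

Import Order.TTheory GRing.Theory Num.Theory.
Local Open Scope ring_scope.

(* The number of enterprises is [n.+1] throughout.  A cost function on        *)
(* [0, +oo) is a total function [R -> R] whose values at negative points are  *)
(* never constrained and never used.                                          *)

Definition increasing_on_nneg (R : realType) (g : R -> R) : Prop :=
  forall x y : R, 0 <= x -> x <= y -> g x <= g y.

Definition strongly_convex_on_nneg (R : realType) (mu : R) (g : R -> R) : Prop :=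
  forall x y t : R, 0 <= x -> 0 <= y -> 0 <= t -> t <= 1 ->
    g (t * x + (1 - t) * y) <=
      t * g x + (1 - t) * g y - mu / 2 * t * (1 - t) * (x - y) ^+ 2.

Definition nneg_vec (R : realType) (n : nat) (v : 'cV[R]_n.+1) : Prop :=
  forall k, 0 <= v k 0.

(* [`| v |] on matrices is the sup norm in the library, hence this one. *)
Definition norm2 (R : realType) (n : nat) (v : 'cV[R]_n.+1) : R :=
  Num.sqrt (\sum_(k < n.+1) v k 0 ^+ 2).

Definition min_coord (R : realType) (n : nat) (v : 'cV[R]_n.+1) : R :=
  \big[Num.min/v 0 0]_(k < n.+1) v k 0.

Definition pos_part (R : realType) (n : nat) (v : 'cV[R]_n.+1) : 'cV[R]_n.+1 :=
  \col_(k < n.+1) Num.max 0 (v k 0).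

Definition is_argmax_nneg (R : realType) (g : R -> R) (x : R) : Prop :=
  0 <= x /\ forall y : R, 0 <= y -> g y <= g x.

(* A chosen maximizer over [0, +oo); 0 (a junk value) if there is none. *)
Definition argmax_nneg (R : realType) (g : R -> R) : R :=
  xget 0 [set x | is_argmax_nneg g x]%classic.

Definition total_cost (R : realType) (n : nat) (f : 'I_n.+1 -> R -> R)
    (x : 'cV[R]_n.+1) : R :=
  \sum_(k < n.+1) f k (x k 0).

Definition feasible (R : realType) (n : nat) (C : R) (x y : 'cV[R]_n.+1) : Prop :=
  C <= \sum_(k < n.+1) y k 0 /\
  forall k, [/\ y k 0 <= x k 0, 0 <= y k 0 & 0 <= x k 0].

Definition is_solution (R : realType) (n : nat) (C : R)
    (f : 'I_n.+1 -> R -> R) (x y : 'cV[R]_n.+1) : Prop :=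
  feasible C x y /\
  forall x' y' : 'cV[R]_n.+1,
    feasible C x' y' -> total_cost f x <= total_cost f x'.

Definition demand (R : realType) (n : nat) (f : 'I_n.+1 -> R -> R)
    (p : 'cV[R]_n.+1) : 'cV[R]_n.+1 :=
  \col_(k < n.+1) argmax_nneg (fun x => p k 0 * x - f k x).

Definition dual_fun (R : realType) (n : nat) (C : R) (f : 'I_n.+1 -> R -> R)
    (p : 'cV[R]_n.+1) : R :=
  \sum_(k < n.+1) (p k 0 * demand f p k 0 - f k (demand f p k 0))
  - C * min_coord p.

Definition min_weights (R : realType) (n : nat) (p l : 'cV[R]_n.+1) : Prop :=
  [/\ forall k, 0 <= l k 0,
      \sum_(k < n.+1) l k 0 = 1
    & forall k, 0 < l k 0 -> p k 0 = min_coord p].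

(* The subgradient of [dual_fun C f] at [p] given by the choice [lambda] of   *)
(* the weights.                                                               *)
Definition subgrad (R : realType) (n : nat) (C : R) (f : 'I_n.+1 -> R -> R)
    (lambda : 'cV[R]_n.+1 -> 'cV[R]_n.+1) (p : 'cV[R]_n.+1) : 'cV[R]_n.+1 :=
  demand f p - C *: lambda p.

Definition p_max (R : realType) (n : nat) (C : R) (f : 'I_n.+1 -> R -> R) : R :=
  C^-1 * \sum_(k < n.+1) (f k (2 * C / n.+1%:R) - f k 0).

Definition radius (R : realType) (n : nat) (C : R) (f : 'I_n.+1 -> R -> R) : R :=
  p_max C f * Num.sqrt n.+1%:R.

Fixpoint price (R : realType) (n : nat) (C : R) (f : 'I_n.+1 -> R -> R)
    (lambda : 'cV[R]_n.+1 -> 'cV[R]_n.+1) (h : R) (t : nat) : 'cV[R]_n.+1 :=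
  if t is s.+1 then
    pos_part (price C f lambda h s
              - h *: subgrad C f lambda (price C f lambda h s))
  else 0.

Definition avg_demand (R : realType) (n : nat) (C : R) (f : 'I_n.+1 -> R -> R)
    (lambda : 'cV[R]_n.+1 -> 'cV[R]_n.+1) (h : R) (N : nat) : 'cV[R]_n.+1 :=
  N%:R^-1 *: \sum_(0 <= t < N) demand f (price C f lambda h t).

Definition avg_price (R : realType) (n : nat) (C : R) (f : 'I_n.+1 -> R -> R)
    (lambda : 'cV[R]_n.+1 -> 'cV[R]_n.+1) (h : R) (N : nat) : 'cV[R]_n.+1 :=
  N%:R^-1 *: \sum_(0 <= t < N) price C f lambda h t.

Definition small_violation (R : realType) (n : nat) (C eps : R)
    (f : 'I_n.+1 -> R -> R) (x : 'cV[R]_n.+1) : Prop :=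
  C - \sum_(k < n.+1) x k 0 <= eps / p_max C f.

Definition eps_solution (R : realType) (n : nat) (C eps : R)
    (f : 'I_n.+1 -> R -> R) (xstar x : 'cV[R]_n.+1) : Prop :=
  total_cost f x - total_cost f xstar <= eps /\ small_violation C eps f x.

Definition stopping_criterion (R : realType) (n : nat) (C eps : R)
    (f : 'I_n.+1 -> R -> R) (x p : 'cV[R]_n.+1) : Prop :=
  total_cost f x + dual_fun C f p <= eps /\ small_violation C eps f x.

(* Main.v *)
From mathcomp Require Import topology normedtype derive.
From mathcomp Require Import ring lra.
Require Import Defs.
From HB Require Import structures.
From mathcomp Require Import all_boot all_order all_algebra.
From mathcomp Require Import boolp classical_sets reals.

Set Implicit Arguments.
Unset Strict Implicit.
Unset Printing Implicit Defensive.

Import Order.TTheory GRing.Theory Num.Theory.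
Import numFieldNormedType.Exports.
Local Open Scope ring_scope.

(** The criterion bounds two numbers attached to the averages of the first [N]
    iterations: the duality gap, and the shortage of the averaged demands.  A
    small gap yields a small primal error by weak duality ([weak_duality]).

    At a price [p] the primal-dual gap of the demanded quantities is exactly
    the pairing of the subgradient with [p], and pairing the subgradient with
    [p - r 1] instead adds [r] times the shortage ([subgrad_gap]).  The classical
    analysis of the projected subgradient method, with the reference point
    [r 1] instead of a dual solution, therefore controls [gap + r * shortage]
    for all [r >= 0] at once ([regret_bound]); Jensen's inequality passes from
    the mean of the iterations to their average.  A positive shortage cannot
    make the gap too negative: mixing the averaged plan with the Slater point
    that produces [2 C / n] everywhere gives [gap >= - p_max * shortage]
    ([gap_ge]).

    With [h = eps / M ^ 2], as long as the subgradients met are bounded by [M],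
    the choice [r = 0] gives a gap of at most [eps / 2], so that a method that
    has not stopped has [p_max * shortage > eps] ([running_shortage]).  Then
    [r = 3 p_max], which has norm [3 R], gives [2 p_max * shortage <= eps] after
    the announced number of iterations: a contradiction.

    The bound [M] is only assumed on the ball of radius [3 R], so the prices
    must be shown to stay there.  This holds as long as the method has not
    stopped: for [r = 3/2 p_max] the term [gap + r * shortage] then exceeds
    [p_max * shortage / 2 > eps / 2], so that the current price is no farther
    from [r 1] than the origin is, and its norm is at most twice that of [r 1],
    that is [3 R] ([price_in_ball]).  The step [h] being fixed, the
    final estimate only asks that [N] be at least the announced number, so that
    rounding up is harmless.  Here and below, [n] in prose is the number of
    enterprises, [n.+1] in the formal text, and [r 1] is the price vector with
    all coordinates equal to [r]. *)

(** * A single cost function *)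

Section CostFunction.
Variables (R : realType) (mu : R) (g : R -> R).
Hypotheses (mu_gt0 : 0 < mu) (g_incr : increasing_on_nneg g).
Hypothesis g_sconvex : strongly_convex_on_nneg mu g.

Lemma strongly_convex_convex (x y t : R) :
  0 <= x -> 0 <= y -> 0 <= t -> t <= 1 ->
  g (t * x + (1 - t) * y) <= t * g x + (1 - t) * g y.
Proof.
move=> x0 y0 t0 t1; apply: le_trans (g_sconvex x0 y0 t0 t1) _.
rewrite gerBl; apply: mulr_ge0; last exact: sqr_ge0.
by rewrite 2?mulr_ge0 ?subr_ge0 ?divr_ge0 ?(ltW mu_gt0).
Qed.

(** Strong convexity at the midpoint of [0] and [x], together with
    [g 0 <= g (x / 2)], forbids equality. *)
Lemma cost_gt_origin (x : R) : 0 < x -> g 0 < g x.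
Proof.
move=> x0.
have h := g_sconvex (ltW x0) (lexx 0) (t := 2^-1) ltac:(lra) ltac:(lra).
have g0 : g 0 <= g (2^-1 * x + (1 - 2^-1) * 0) by apply: g_incr; lra.
have : 0 < mu * x ^+ 2 by rewrite mulr_gt0 ?exprn_gt0.
by nra.
Qed.

Lemma cost_jensen (x : nat -> R) (N : nat) : (0 < N)%N ->
  (forall t, 0 <= x t) ->
  g (N%:R^-1 * \sum_(0 <= t < N) x t) <= N%:R^-1 * \sum_(0 <= t < N) g (x t).
Proof.
move=> + x0; elim: N => // -[_ _|N IH _]; first by rewrite !big_nat1 invr1 !mul1r.
have {}IH := IH isT.
rewrite big_nat_recr //= [X in _ <= _ * X]big_nat_recr //=.
set S := \sum_(0 <= t < N.+1) x t in IH *.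
set G := \sum_(0 <= t < N.+1) g (x t) in IH *.
have m0 : (0 : R) < N.+1%:R by rewrite ltr0n.
have -> : N.+2%:R = N.+1%:R + 1 :> R by rewrite -natr1.
move: m0 IH; set m : R := N.+1%:R => m0 IH.
have S0 : 0 <= m^-1 * S.
  by rewrite mulr_ge0 ?invr_ge0 ?(ltW m0) // sumr_ge0.
have t0 : 0 <= (m + 1)^-1 by rewrite invr_ge0; lra.
have t1 : (m + 1)^-1 <= 1 by rewrite invf_le1; lra.
have := strongly_convex_convex (x0 N.+1) S0 t0 t1.
have -> : (m + 1)^-1 * x N.+1 + (1 - (m + 1)^-1) * (m^-1 * S)
          = (m + 1)^-1 * (S + x N.+1) by field; lra.
move=> /le_trans; apply.
have -> : (m + 1)^-1 * (G + g (x N.+1))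
          = (m + 1)^-1 * g (x N.+1) + (1 - (m + 1)^-1) * (m^-1 * G).
  by field; lra.
rewrite lerD2l ler_wpM2l //; lra.
Qed.

(** The chord slopes of a convex function increase, so the one from [y] to [x] is
    at most the one from [y] to [K + 1], whose run is at least [1].  Monotonicity
    supplies continuity at the endpoint [0], where convexity alone does not. *)
Lemma cost_lipschitz (K x y : R) : 0 <= y -> y <= x -> x <= K ->
  g x - g y <= (g (K + 1) - g 0) * (x - y).
Proof.
move=> y0 yx xK; set z := K + 1.
have d0 : 0 < z - y by rewrite /z; lra.
have z0 : 0 <= z by rewrite /z; lra.
pose t := (x - y) / (z - y).
have t0 : 0 <= t by rewrite divr_ge0 //; lra.
have t1 : t <= 1 by rewrite ler_pdivrMr // /z; lra.
have := strongly_convex_convex z0 y0 t0 t1.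
have -> : t * z + (1 - t) * y = x by rewrite /t; field; lra.
have g0 : g 0 <= g y by apply: g_incr.
have gz : g y <= g z by apply: g_incr => //; lra.
have tx : t <= x - y by rewrite ler_pdivrMr // ler_peMr /z; lra.
have : t * (g z - g y) <= (x - y) * (g z - g 0) by apply: ler_pM => //; lra.
lra.
Qed.

Lemma revenue_continuous (p K : R) : 
  {within `[0, K], continuous (fun x => p * x - g x)}%classic.
Proof.
apply/subspace_continuousP => x; rewrite /= in_itv /= => /andP[x0 xK].
apply/cvgrPdist_le => e e0; rewrite near_withinE.
pose L := `|p| + (g (K + 1) - g 0).
have gK : g 0 <= g (K + 1) by apply: g_incr; lra.
have L0 : 0 <= L by rewrite addr_ge0 ?subr_ge0.
have L1 : 0 < L + 1 by lra.
near=> y; rewrite /= in_itv /= => /andP[y0 yK].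
have xy : `|x - y| <= e / (L + 1).
  near: y; apply/nbhs_ballP; exists (e / (L + 1)); first exact: divr_gt0.
  by move=> z /ltW.
have gxy : `|g x - g y| <= (g (K + 1) - g 0) * `|x - y|.
  have [yx|/ltW xy'] := leP y x.
    rewrite !ger0_norm ?subr_ge0 //; first exact: cost_lipschitz.
    exact: g_incr.
  rewrite !(distrC _ y, distrC _ (g y)) !ger0_norm ?subr_ge0 //.
    exact: cost_lipschitz.
  exact: g_incr.
have -> : p * x - g x - (p * y - g y) = p * (x - y) - (g x - g y) by ring.
apply: le_trans (ler_normB _ _) _; rewrite normrM.
apply: le_trans (_ : L * `|x - y| <= _); first by rewrite mulrDl lerD2l.
apply: le_trans (_ : (L + 1) * `|x - y| <= _); first by rewrite ler_wpM2r //; lra.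
by rewrite mulrC -ler_pdivlMr.
Unshelve. all: by end_near.
Qed.

(** By strong convexity the cost eventually dominates the linear income: beyond
    [1 + 2 p / mu] producing nothing is already better, so that the supremum
    over the half-line is attained on a compact interval. *)
Lemma revenue_max (p : R) : 0 <= p ->
  exists x, is_argmax_nneg (fun x => p * x - g x) x.
Proof.
move=> p0; pose K := 1 + 2 * p / mu.
have q0 : 0 <= 2 * p / mu by rewrite divr_ge0 ?(ltW mu_gt0) //; lra.
have K0 : 0 <= K by rewrite /K; lra.
have [x] := EVT_max K0 (@revenue_continuous p K).
rewrite in_itv /= => /andP[x0 xK] xmax; exists x; split=> // y y0.
have [yK|Ky] := leP y K; first by apply: xmax; rewrite in_itv /= y0 yK.
apply: le_trans (xmax 0 _); last by rewrite in_itv /= lexx K0.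
have y1 : 1 < y by apply: le_lt_trans Ky; rewrite lerDl.
have yi0 : 0 <= y^-1 by rewrite invr_ge0.
have yi1 : y^-1 <= 1 by rewrite invf_le1; lra.
have := g_sconvex y0 (lexx 0) yi0 yi1.
rewrite mulr0 addr0 mulVf ?gt_eqF //; last lra.
have g1 : g 0 <= g 1 by apply: g_incr; lra.
move=> h.
have : y * g 1 <= y * (y^-1 * g y + (1 - y^-1) * g 0
          - mu / 2 * y^-1 * (1 - y^-1) * (y - 0) ^+ 2) by rewrite ler_wpM2l.
have -> : y * (y^-1 * g y + (1 - y^-1) * g 0
          - mu / 2 * y^-1 * (1 - y^-1) * (y - 0) ^+ 2)
  = g y + (y - 1) * g 0 - mu / 2 * (y - 1) * y by field; lra.
have : y * g 0 <= y * g 1 by rewrite ler_wpM2l.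
have : 2 * p < mu * (y - 1).
  by rewrite [ltRHS]mulrC -ltr_pdivrMr // ltrBrDl.
rewrite -(ltr_pM2r (x := y)); last lra.
lra.
Qed.
End CostFunction.

(** * Duality *)

Section Allocation.
Variables (R : realType) (n : nat) (C mu : R) (f : 'I_n.+1 -> R -> R).
Hypotheses (C_gt0 : 0 < C) (mu_gt0 : 0 < mu).
Hypothesis f_incr : forall k, increasing_on_nneg (f k).
Hypothesis f_sconvex : forall k, strongly_convex_on_nneg mu (f k).
Implicit Types p x y : 'cV[R]_n.+1.

Definition gap x p : R := total_cost f x + dual_fun C f p.

Definition shortage x : R := C - \sum_(k < n.+1) x k 0.

Lemma demand_argmax p k : nneg_vec p ->
  is_argmax_nneg (fun z => p k 0 * z - f k z) (demand f p k 0).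
Proof.
move=> p0; rewrite mxE.
apply: (@xgetPex _ 0 [set z | is_argmax_nneg (fun z => p k 0 * z - f k z) z]%classic).
exact: (revenue_max mu_gt0 (@f_incr k) (@f_sconvex k) (p0 k)).
Qed.

Lemma demand_ge0 p : nneg_vec p -> nneg_vec (demand f p).
Proof. by move=> p0 k; have [] := demand_argmax k p0. Qed.

Lemma min_coord_le p k : min_coord p <= p k 0.
Proof. exact: bigmin_le_cond. Qed.

Lemma le_min_coord (a : R) p : (forall k, a <= p k 0) -> a <= min_coord p.
Proof. by move=> ap; apply: le_bigmin. Qed.

Lemma p_max_gt0 : 0 < p_max C f.
Proof.
have z0 : 0 < 2 * C / n.+1%:R by rewrite !mulr_gt0 ?invr_gt0 ?ltr0n.
have d0 k : 0 < f k (2 * C / n.+1%:R) - f k 0.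
  by rewrite subr_gt0; apply: (cost_gt_origin mu_gt0 (@f_incr k) (@f_sconvex k)).
rewrite mulr_gt0 ?invr_gt0 // big_ord_recl ltr_pwDl ?sumr_ge0 // => k _.
exact: ltW.
Qed.

Lemma weak_duality p x y : nneg_vec p -> feasible C x y ->
  - total_cost f x <= dual_fun C f p.
Proof.
move=> p0 [yC xy].
have m0 : 0 <= min_coord p by exact: le_min_coord.
have le_rev : \sum_(k < n.+1) (min_coord p * y k 0 - f k (x k 0))
    <= \sum_(k < n.+1) (p k 0 * demand f p k 0 - f k (demand f p k 0)).
  apply: ler_sum => k _; have [yx y0 x0] := xy k.
  have [_ /(_ _ x0)] := demand_argmax k p0; apply: le_trans.
  by rewrite lerB // ler_pM // min_coord_le.
rewrite /dual_fun /total_cost; move: le_rev; rewrite sumrB -mulr_sumr.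
have : C * min_coord p <= min_coord p * \sum_(k < n.+1) y k 0.
  by rewrite mulrC ler_wpM2l.
lra.
Qed.

(** Moving from [x] towards the plan [z = 2 C / n] in every coordinate, whose
    total is [2 C], reaches the total [C] at the fraction
    [th = shortage / (C + shortage) <= shortage / C].  The feasible plan [w] so
    obtained costs at most [th * \sum_k (f_k z - f_k 0) <= p_max * shortage]
    more than [x], and weak duality applies to [w]. *)
Lemma gap_ge x p : nneg_vec x -> nneg_vec p -> 0 <= shortage x ->
  - (p_max C f * shortage x) <= gap x p.
Proof.
rewrite /shortage /gap; set S := \sum_(k < n.+1) x k 0 => x0 p0 v0.
have S0 : 0 <= S by rewrite sumr_ge0.
have n0 : (0 : R) < n.+1%:R by rewrite ltr0n.
have CS0 : 0 < 2 * C - S by have := C_gt0; lra.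
pose z := 2 * C / n.+1%:R.
have z0 : 0 <= z by rewrite mulr_ge0 ?invr_ge0 ?(ltW n0) // mulr_ge0 ?(ltW C_gt0).
pose th := (C - S) / (2 * C - S).
have th0 : 0 <= th by rewrite divr_ge0 // ltW.
have th1 : th <= 1 by rewrite ler_pdivrMr // mul1r; have := C_gt0; lra.
have thC : th <= (C - S) / C.
  by rewrite ler_wpM2l // lef_pV2 ?posrE //; lra.
pose w : 'cV[R]_n.+1 := \col_k (th * z + (1 - th) * x k 0).
have wk k : w k 0 = th * z + (1 - th) * x k 0 by rewrite mxE.
have w0 k : 0 <= w k 0.
  by rewrite wk addr_ge0 // mulr_ge0 ?subr_ge0.
have w_feas : feasible C w w.
  split=> [|k]; last by split.
  under eq_bigr do rewrite wk.
  rewrite big_split /= sumr_const card_ord -mulr_sumr -/S -mulr_natr.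
  rewrite [leRHS](_ : _ = C) // /th /z; field.
  by rewrite -natr1 addrC in n0; rewrite !gt_eqF.
have := weak_duality p0 w_feas.
have fw : total_cost f w <= total_cost f x + th * \sum_(k < n.+1) (f k z - f k 0).
  rewrite mulr_sumr -big_split; apply: ler_sum => k _; rewrite wk.
  apply: le_trans (strongly_convex_convex mu_gt0 (@f_sconvex k) _ _ th0 th1) _ => //.
  have : th * f k 0 <= th * f k (x k 0) by rewrite ler_wpM2l ?f_incr.
  by rewrite /=; lra.
have F0 : 0 <= \sum_(k < n.+1) (f k z - f k 0).
  by rewrite sumr_ge0 // => k _; rewrite subr_ge0 f_incr.
have : th * \sum_(k < n.+1) (f k z - f k 0) <= p_max C f * (C - S).
  apply: le_trans (ler_wpM2r F0 thC) _.
  by rewrite /p_max -/z [leRHS]mulrC [leRHS]mulrA.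
lra.
Qed.

(** * The projected subgradient method *)

Section Method.
Variables (lambda : 'cV[R]_n.+1 -> 'cV[R]_n.+1).
Hypothesis lambda_weights : forall p, nneg_vec p -> min_weights p (lambda p).

Lemma subgradE p k :
  subgrad C f lambda p k 0 = demand f p k 0 - C * lambda p k 0.
Proof. by rewrite !mxE. Qed.

(** Pairing the weights with [p] gives [min_coord p], since they are supported on
    the coordinates where the minimum is attained; pairing them with the
    constant vector gives [1]. *)
Lemma subgrad_gap (r : R) p : nneg_vec p ->
  \sum_(k < n.+1) subgrad C f lambda p k 0 * (p k 0 - r)
  = gap (demand f p) p + r * shortage (demand f p).
Proof.
move=> p0; have [l0 l1 lmin] := lambda_weights p0.
have lp k : lambda p k 0 * p k 0 = lambda p k 0 * min_coord p.
  have := l0 k; rewrite le_eqVlt => /orP[/eqP<-|/lmin->//]; by rewrite !mul0r.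
rewrite /gap /shortage /total_cost /dual_fun sumrB.
have -> : \sum_(k < n.+1) subgrad C f lambda p k 0 * (p k 0 - r)
  = \sum_(k < n.+1) (p k 0 * demand f p k 0 - r * demand f p k 0
       - C * (min_coord p - r) * lambda p k 0).
  apply: eq_bigr => k _; rewrite subgradE mulrBl.
  have -> : C * lambda p k 0 * (p k 0 - r)
    = C * (lambda p k 0 * p k 0) - C * r * lambda p k 0 by ring.
  by rewrite lp; ring.
rewrite !sumrB -!mulr_sumr l1; ring.
Qed.

Variable h : R.
Hypothesis h_gt0 : 0 < h.
Local Notation price_ := (price C f lambda h).

Lemma price_ge0 t : nneg_vec (price_ t).
Proof.
by case: t => [|t] k; rewrite /= mxE // le_max lexx.
Qed.

(** The projection onto the nonnegative orthant does not increase the distance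
    to the point [r 1] of that orthant. *)
Lemma price_dist_step (r : R) t : 0 <= r ->
  \sum_(k < n.+1) (price_ t.+1 k 0 - r) ^+ 2
  <= \sum_(k < n.+1) (price_ t k 0 - r) ^+ 2
     - 2 * h * (gap (demand f (price_ t)) (price_ t)
                + r * shortage (demand f (price_ t)))
     + h ^+ 2 * norm2 (subgrad C f lambda (price_ t)) ^+ 2.
Proof.
move=> r0; rewrite -(subgrad_gap r (@price_ge0 t)) sqr_sqrtr; last first.
  by rewrite sumr_ge0 // => k _; rewrite sqr_ge0.
rewrite !mulr_sumr -sumrB -big_split /=; apply: ler_sum => k _.
rewrite [in leLHS]mxE; set p := price_ t; set g := subgrad C f lambda p.
have -> : (p - h *: g) k 0 = p k 0 - h * g k 0 by rewrite !mxE.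
apply: (@le_trans _ _ ((p k 0 - h * g k 0 - r) ^+ 2)); last by lra.
have [//|a0] := leP 0 (p k 0 - h * g k 0).
by nra.
Qed.

Lemma avg_demandE N k :
  avg_demand C f lambda h N k 0
  = N%:R^-1 * \sum_(0 <= t < N) demand f (price_ t) k 0.
Proof. by rewrite mxE summxE. Qed.

Lemma avg_priceE N k :
  avg_price C f lambda h N k 0 = N%:R^-1 * \sum_(0 <= t < N) price_ t k 0.
Proof. by rewrite mxE summxE. Qed.

Lemma avg_demand_ge0 N : nneg_vec (avg_demand C f lambda h N).
Proof.
move=> k; rewrite avg_demandE mulr_ge0 ?invr_ge0 // sumr_ge0 // => t _.
exact/demand_ge0/price_ge0.
Qed.

Lemma avg_price_ge0 N : nneg_vec (avg_price C f lambda h N).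
Proof.
move=> k; rewrite avg_priceE mulr_ge0 ?invr_ge0 // sumr_ge0 // => t _.
exact: price_ge0.
Qed.

Lemma total_cost_avg N : (0 < N)%N ->
  total_cost f (avg_demand C f lambda h N)
  <= N%:R^-1 * \sum_(0 <= t < N) total_cost f (demand f (price_ t)).
Proof.
move=> N0; rewrite exchange_big mulr_sumr; apply: ler_sum => k _.
rewrite avg_demandE; apply: (cost_jensen mu_gt0 (@f_sconvex k)) => // t.
exact/demand_ge0/price_ge0.
Qed.

Lemma mean_const N (a : R) : (0 < N)%N -> a = N%:R^-1 * \sum_(0 <= t < N) a.
Proof.
move=> N0; rewrite sumr_const_nat subn0 -[a *+ _]mulr_natl mulKf //.
by rewrite pnatr_eq0 -lt0n.
Qed.

(** Convexity of the dual function: the demands at the average price are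
    admissible competitors at each price [price_ t], and the minimal coordinate
    is concave. *)
Lemma dual_fun_avg N : (0 < N)%N ->
  dual_fun C f (avg_price C f lambda h N)
  <= N%:R^-1 * \sum_(0 <= t < N) dual_fun C f (price_ t).
Proof.
move=> N0; have Ni0 : 0 <= N%:R^-1 :> R by rewrite invr_ge0.
set pb := avg_price C f lambda h N.
rewrite sumrB mulrBr lerB //.
  rewrite exchange_big mulr_sumr; apply: ler_sum => k _.
  rewrite [X in _ - X](mean_const _ N0) avg_priceE -mulrA -mulrBr mulr_suml -sumrB.
  rewrite ler_wpM2l //; apply: ler_sum => t _.
  have [_] := demand_argmax k (@price_ge0 t); apply.
  exact/demand_ge0/avg_price_ge0.
rewrite -mulr_sumr mulrCA ler_wpM2l ?(ltW C_gt0) //.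
apply: le_min_coord => k; rewrite avg_priceE ler_wpM2l //.
by apply: ler_sum => t _; exact: min_coord_le.
Qed.

Lemma shortage_avg N : (0 < N)%N ->
  shortage (avg_demand C f lambda h N)
  = N%:R^-1 * \sum_(0 <= t < N) shortage (demand f (price_ t)).
Proof.
move=> N0; rewrite /shortage sumrB mulrBr -mean_const // exchange_big mulr_sumr.
by congr (_ - _); apply: eq_bigr => k _; rewrite avg_demandE.
Qed.

(** The one-step estimates telescope; the first term on the right is the squared
    distance from the initial price [0] to [r 1]. *)
Lemma regret_bound (M r : R) N : (0 < N)%N -> 0 <= r ->
  (forall t, (t < N)%N -> norm2 (subgrad C f lambda (price_ t)) <= M) ->
  \sum_(k < n.+1) (price_ N k 0 - r) ^+ 2
  + 2 * h * N%:R * (gap (avg_demand C f lambda h N) (avg_price C f lambda h N)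
                    + r * shortage (avg_demand C f lambda h N))
  <= n.+1%:R * r ^+ 2 + N%:R * (h ^+ 2 * M ^+ 2).
Proof.
move=> N0 r0 gM.
pose G t := gap (demand f (price_ t)) (price_ t)
            + r * shortage (demand f (price_ t)).
have tele m : (m <= N)%N ->
    \sum_(k < n.+1) (price_ m k 0 - r) ^+ 2 + 2 * h * \sum_(0 <= t < m) G t
    <= n.+1%:R * r ^+ 2 + m%:R * (h ^+ 2 * M ^+ 2).
  elim: m => [_|m IH mN].
    rewrite big_nil mulr0 mul0r !addr0.
    under eq_bigr do rewrite mxE sub0r sqrrN.
    by rewrite sumr_const card_ord -[r ^+ 2 *+ _]mulr_natl.
  have {IH} := IH (ltnW mN); have := price_dist_step m r0; rewrite -/(G m).
  have -> : \sum_(0 <= t < m.+1) G t = \sum_(0 <= t < m) G t + G m.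
    by rewrite big_nat_recr.
  rewrite -[m.+1%:R]natr1.
  have : h ^+ 2 * norm2 (subgrad C f lambda (price_ m)) ^+ 2 <= h ^+ 2 * M ^+ 2.
    have g0 : 0 <= norm2 (subgrad C f lambda (price_ m)) := sqrtr_ge0 _.
    rewrite ler_wpM2l ?sqr_ge0 // lerXn2r ?nnegrE ?gM //.
    exact: le_trans g0 (gM m mN).
  lra.
apply: le_trans (tele N (leqnn N)); rewrite lerD2l -mulrA ler_wpM2l //.
  by rewrite mulr_ge0 ?(ltW h_gt0).
have NR : 0 < N%:R :> R by rewrite ltr0n.
rewrite -ler_pdivlMl // /G big_split /= -mulr_sumr [leRHS]mulrDr.
rewrite [X in _ <= _ + X]mulrCA -shortage_avg // lerD2r /gap big_split mulrDr lerD //.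
  exact: total_cost_avg.
exact: dual_fun_avg.
Qed.

(** * Stopping *)

Variables (M eps : R).
Hypotheses (eps_gt0 : 0 < eps) (hM : h * M ^+ 2 = eps).
Hypothesis subgrad_le : forall p, nneg_vec p -> norm2 p <= 3 * radius C f ->
  norm2 (subgrad C f lambda p) <= M.

Local Notation xavg := (avg_demand C f lambda h).
Local Notation pavg := (avg_price C f lambda h).
Local Notation stops := (fun N => stopping_criterion C eps f (xavg N) (pavg N)).
Local Notation in_ball p := (norm2 p <= 3 * radius C f).

Lemma in_ball_sum p :
  \sum_(k < n.+1) p k 0 ^+ 2 <= 9 * n.+1%:R * p_max C f ^+ 2 -> in_ball p.
Proof.
have p0 := ltW p_max_gt0.
have r0 : 0 <= 3 * radius C f by rewrite mulr_ge0 // mulr_ge0 // sqrtr_ge0.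
move=> p_le; rewrite -[leRHS](ger0_norm r0) -sqrtr_sqr ler_sqrt ?sqr_ge0 //.
apply: le_trans p_le _.
rewrite /radius !exprMn sqr_sqrtr //; lra.
Qed.

Lemma regret_bound_eps (r : R) N : (0 < N)%N -> 0 <= r ->
  (forall t, (t < N)%N -> in_ball (price_ t)) ->
  \sum_(k < n.+1) (price_ N k 0 - r) ^+ 2
  + 2 * h * N%:R * (gap (xavg N) (pavg N) + r * shortage (xavg N) - eps / 2)
  <= n.+1%:R * r ^+ 2.
Proof.
move=> N0 r0 ball.
have := @regret_bound M r N N0 r0 (fun t tN => subgrad_le (@price_ge0 t) (ball t tN)).
have -> : h ^+ 2 * M ^+ 2 = h * eps by rewrite -hM; ring.
lra.
Qed.

(** The regret bound at [r = 0] shows that the gap part of the criterion already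
    holds, so only the constraint can be violated. *)
Lemma running_shortage N : (0 < N)%N ->
  (forall t, (t < N)%N -> in_ball (price_ t)) -> ~ stops N ->
  eps < p_max C f * shortage (xavg N).
Proof.
move=> N0 ball Nstop; rewrite ltNge; apply/negP => short; apply: Nstop.
split; last by rewrite /small_violation ler_pdivlMr ?p_max_gt0 // mulrC.
have hN : 0 < 2 * h * N%:R by rewrite !mulr_gt0 ?ltr0n.
have := regret_bound_eps N0 (lexx 0) ball.
rewrite mul0r addr0 expr0n mulr0 => reg.
have sq : 0 <= \sum_(k < n.+1) (price_ N k 0 - 0) ^+ 2.
  by rewrite sumr_ge0 // => k _; rewrite sqr_ge0.
have : 2 * h * N%:R * (gap (xavg N) (pavg N) - eps / 2) <= 0 by lra.
rewrite pmulr_rle0 // /gap; have := eps_gt0; lra.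
Qed.

Lemma running_gap N : eps < p_max C f * shortage (xavg N) ->
  - (p_max C f * shortage (xavg N)) <= gap (xavg N) (pavg N).
Proof.
move=> short; apply: gap_ge; [exact: avg_demand_ge0|exact: avg_price_ge0|].
rewrite -(pmulr_rge0 _ p_max_gt0); exact: ltW (lt_trans eps_gt0 short).
Qed.

(** Before the method stops, [r = 3/2 p_max] makes the bracket in the regret
    bound nonnegative: since [gap >= - p_max * shortage], it is at least
    [(r - p_max) * shortage - eps / 2 = (p_max * shortage - eps) / 2].  Hence the
    price is within [|r 1|] of [r 1]. *)
Lemma price_in_ball N : (forall m, (0 < m <= N)%N -> ~ stops m) ->
  forall t, (t <= N)%N -> in_ball (price_ t).
Proof.
move=> Nstop; elim/ltn_ind => -[_ _|t IH tN].
  apply: in_ball_sum; under eq_bigr do rewrite mxE expr0n.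
  by rewrite big1_eq mulr_ge0 ?sqr_ge0 // mulr_ge0.
have ball s : (s < t.+1)%N -> in_ball (price_ s).
  by move=> st; apply: IH => //; exact: leq_trans (ltnW st) tN.
have short := running_shortage (ltn0Sn t) ball (Nstop t.+1 tN).
have gap_lb := running_gap short.
have pm := p_max_gt0.
pose r := 3 / 2 * p_max C f.
have r0 : 0 <= r by rewrite mulr_ge0 ?(ltW pm) //; lra.
have := regret_bound_eps (ltn0Sn t) r0 ball.
set G := gap _ _ + _ - _; have G0 : 0 <= G by rewrite /G /r; lra.
have : 0 <= 2 * h * t.+1%:R * G by rewrite mulr_ge0 // mulr_ge0 // mulr_ge0 // ltW.
move=> hG0 reg.
have {hG0 reg} dist : \sum_(k < n.+1) (price_ t.+1 k 0 - r) ^+ 2 <= n.+1%:R * r ^+ 2.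
  lra.
apply: in_ball_sum.
apply: (@le_trans _ _ (\sum_(k < n.+1) (2 * (price_ t.+1 k 0 - r) ^+ 2 + 2 * r ^+ 2))).
  apply: ler_sum => k _; have := sqr_ge0 (price_ t.+1 k 0 - r - r).
  (* [a ^ 2 <= 2 (a - r) ^ 2 + 2 r ^ 2], as the difference is [(a - 2 r) ^ 2]. *)
  lra.
rewrite big_split /= -mulr_sumr sumr_const card_ord -[_ *+ n.+1]mulr_natl.
have -> : 9 * n.+1%:R * p_max C f ^+ 2 = 4 * (n.+1%:R * r ^+ 2) by rewrite /r; field.
lra.
Qed.

(** The reference point [3 p_max 1] has squared norm [9 n p_max ^ 2], which the
    hypothesis on [N] dominates; the regret bound then gives
    [gap + 3 p_max * shortage <= eps], incompatible with [running_shortage] and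
    [running_gap]. *)
Lemma method_stops N : (0 < N)%N ->
  9 * n.+1%:R * p_max C f ^+ 2 <= N%:R * (h * eps) ->
  exists2 m, (0 < m <= N)%N & stops m.
Proof.
move=> N0 large; apply: contrapT => noStop.
have Nstop m : (0 < m <= N)%N -> ~ stops m by move=> mN sm; apply: noStop; exists m.
have ball t (tN : (t < N)%N) := price_in_ball Nstop (ltnW tN).
have NN : (0 < N <= N)%N by rewrite N0 leqnn.
have short := running_shortage N0 ball (Nstop N NN).
have gap_lb := running_gap short.
have pm := p_max_gt0.
have r0 : 0 <= 3 * p_max C f by rewrite mulr_ge0 ?(ltW pm).
have := regret_bound_eps N0 r0 ball.
set S := \sum_(k < n.+1) _; have S0 : 0 <= S.
  by rewrite sumr_ge0 // => k _; rewrite sqr_ge0.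
move=> reg.
have hN : 0 < 2 * h * N%:R by rewrite !mulr_gt0 ?ltr0n.
have : 2 * h * N%:R * (gap (xavg N) (pavg N)
          + 3 * p_max C f * shortage (xavg N) - eps) <= 0 by lra.
rewrite pmulr_rle0 //; have := eps_gt0; lra.
Qed.

End Method.
End Allocation.

Theorem mainTheorem2 (R : realType) (n : nat) (C mu M eps : R)
    (f : 'I_n.+1 -> R -> R) (lambda : 'cV[R]_n.+1 -> 'cV[R]_n.+1)
    (C_gt0 : 0 < C) (mu_gt0 : 0 < mu) (M_gt0 : 0 < M) (eps_gt0 : 0 < eps)
    (f_incr : forall k, increasing_on_nneg (f k))
    (f_sconvex : forall k, strongly_convex_on_nneg mu (f k))
    (lambda_weights :
       forall p : 'cV[R]_n.+1, nneg_vec p -> min_weights p (lambda p))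
    (subgrad_le :
       forall p : 'cV[R]_n.+1, nneg_vec p -> norm2 p <= 3 * radius C f ->
         norm2 (subgrad C f lambda p) <= M) :
  (forall (h : R) (N : nat) (xstar ystar : 'cV[R]_n.+1),
     0 < h -> (0 < N)%N -> is_solution C f xstar ystar ->
     stopping_criterion C eps f (avg_demand C f lambda h N)
                                (avg_price C f lambda h N) ->
     eps_solution C eps f xstar (avg_demand C f lambda h N))
  /\
  (let Nmax : R := 9 * n.+1%:R * (M * p_max C f) ^+ 2 / eps ^+ 2 in
   let h : R := 3 * p_max C f * Num.sqrt n.+1%:R / (M * Num.sqrt Nmax) in
   h = eps / M ^+ 2 /\
   exists N : nat,
     [/\ (0 < N)%N, N%:Z <= Num.ceil Nmax
       & stopping_criterion C eps f (avg_demand C f lambda h N)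
                                    (avg_price C f lambda h N)]).
Proof.
have pm : 0 < p_max C f by apply: (p_max_gt0 C_gt0 mu_gt0).
split=> [h N xs ys h0 N0 [feas _] [gap_le viol_le]|Nmax h].
  split=> //; apply: le_trans gap_le; rewrite lerD2l.
  apply: (weak_duality mu_gt0 f_incr f_sconvex _ feas).
  exact: (avg_price_ge0 C f lambda h N).
have n0 : 0 < n.+1%:R :> R by rewrite ltr0n.
have hE : h = eps / M ^+ 2.
  have s0 : 0 < Num.sqrt n.+1%:R :> R by rewrite sqrtr_gt0.
  have -> : h = 3 * p_max C f * Num.sqrt n.+1%:R / (M * Num.sqrt Nmax) by [].
  have -> : Nmax = (3 * M * p_max C f * Num.sqrt n.+1%:R / eps) ^+ 2.
    rewrite /Nmax -{1}(sqr_sqrtr (ltW n0)); field; lra.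
  rewrite sqrtr_sqr ger0_norm; first by field; rewrite !gt_eqF.
  by rewrite divr_ge0 ?(ltW eps_gt0) // 2?mulr_ge0 ?(ltW s0) ?(ltW pm) // mulr_ge0 // ltW.
split=> //.
have h0 : 0 < h by rewrite hE divr_gt0 ?exprn_gt0.
have hM : h * M ^+ 2 = eps by rewrite hE; field; lra.
have Nmax0 : 0 < Nmax.
  by rewrite divr_gt0 ?exprn_gt0 // mulr_gt0 ?exprn_gt0 // mulr_gt0.
have ceilE : Num.ceil Nmax = `|Num.ceil Nmax|%N%:Z.
  by rewrite gez0_abs // ltW // ceil_gt0.
have N0 : (0 < `|Num.ceil Nmax|)%N by rewrite absz_gt0 gt_eqF // ceil_gt0.
have Nge : Nmax <= `|Num.ceil Nmax|%N%:R.
  by apply: le_trans (ceil_ge Nmax) _; rewrite {1}ceilE.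
have large : 9 * n.+1%:R * p_max C f ^+ 2 <= `|Num.ceil Nmax|%N%:R * (h * eps).
  apply: (@le_trans _ _ (Nmax * (h * eps))).
    rewrite hE /Nmax [leRHS](_ : _ = 9 * n.+1%:R * p_max C f ^+ 2) //.
    by field; rewrite !gt_eqF.
  by rewrite ler_wpM2r // mulr_ge0 // ltW.
have [m /andP[m0 mN] stop] := method_stops C_gt0 mu_gt0 f_incr f_sconvex
  lambda_weights h0 eps_gt0 hM subgrad_le N0 large.
by exists m; split=> //; rewrite ceilE lez_nat.
Qed.
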